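(* Let $A\in\mathbb{R}^{n\times n}$ be a symmetric positive semidefinite doubly stochastic matrix with eigenvalues $1=\lambda_1>\lambda_2\ge\dots\ge\lambda_n\ge0$. Then $$\mathrm{Perm}(A)\le\frac{n!}{n^n}\prod_{i=2}^n\frac{1}{1-\lambda_i}.$$
   Context: A doubly stochastic matrix is a square matrix with nonnegative entries whose rows and columns all sum to $1$. The permanent of $A=(a_{ij})_{i,j\in[n]}$ is $\mathrm{Perm}(A)=\sum_{\pi\in S_n}\prod_{i=1}^na_{i\pi(i)}$, where $S_n$ is the permutation group of $\{1,\dots,n\}$. *)

(* Defs.v *)
From mathcomp Require Import all_boot all_order fingroup perm all_algebra.

Set Implicit Arguments.
Unset Strict Implicit.
Unset Printing Implicit Defensive.

Local Open Scope ring_scope.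

Definition permanent (R : pzRingType) (n : nat) (A : 'M[R]_n) : R :=
  \sum_(s : 'S_n) \prod_(i < n) A i (s i).

Definition doubly_stochastic (R : numDomainType) (n : nat) (A : 'M[R]_n) :
    Prop :=
  [/\ forall i j, 0 <= A i j,
      forall i, \sum_(j < n) A i j = 1
    & forall j, \sum_(i < n) A i j = 1].

Definition positive_semidefinite (R : numDomainType) (n : nat)
    (A : 'M[R]_n) : Prop :=
  forall x : 'cV[R]_n, 0 <= (x^T *m A *m x) 0 0.

(* [lam 1, ..., lam n] are the eigenvalues of [A] with their multiplicities.
   The list is indexed from 1; the values of [lam] outside of [1, n] are
   irrelevant. *)
Definition eigenvalues_of (R : comNzRingType) (n : nat) (A : 'M[R]_n)
    (lam : nat -> R) : Prop :=
  char_poly A = \prod_(1 <= i < n.+1) ('X - (lam i)%:P).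

(* Main.v *)
Require Import Defs.
From mathcomp Require Import all_boot all_order all_algebra.
From mathcomp Require Import fingroup perm cyclic separable cyclotomic.
From mathcomp Require Import reals complex.
From mathcomp Require Import ring lra zify.

Set Implicit Arguments.
Unset Strict Implicit.
Unset Printing Implicit Defensive.

Import Order.TTheory GRing.Theory Num.Theory.

Local Open Scope ring_scope.

(** If [z] is a centred complex Gaussian vector with covariance [A], then
    [Perm(A) = E prod_i |z_i|^2], so by AM-GM
    [n^n Perm(A) <= E (sum_i |z_i|^2)^n = n! h_n(lam_1, ..., lam_n)], where [h_n]
    is the complete homogeneous symmetric polynomial.  Since [lam_1 = 1],
    [h_n(lam) <= prod_(i >= 2) sum_k lam_i^k].  The Gaussians are replaced by
    sums of [N] independent uniform [(n+1)]-st roots of unity, whose relevant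
    moments count labelled rearrangements and converge as [N] grows. *)


(** * Words, their contents and their rearrangements *)

Section Rearrangements.

Variables (X : finType) (n : nat).
Implicit Types x y : {ffun 'I_n -> X}.

Definition multiplicity x e := #|[pred i | x i == e]|.

Definition same_content x y := [forall e, multiplicity x e == multiplicity y e].

Definition permute x (p : 'S_n) : {ffun 'I_n -> X} := [ffun i => x (p i)].

(** By Wick's formula this is the moment E[prod_i g(x i) * conj(prod_i g(y i))] of independent
    standard complex Gaussians g(e). *)
Definition rearrangements x y := #|[pred p : 'S_n | permute x p == y]|.

Lemma multiplicity_le x e : (multiplicity x e <= n)%N.
Proof. by rewrite -[X in (_ <= X)%N]card_ord max_card. Qed.

Lemma sum_multiplicity x : (\sum_e multiplicity x e)%N = n.
Proof.
rewrite -[RHS]card_ord -sum1_card (partition_big x predT) //=.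
by apply: eq_bigr => e _; rewrite sum1_card.
Qed.

Lemma prod_multiplicity (R : comPzRingType) (F : X -> R) x :
  \prod_i F (x i) = \prod_e F e ^+ multiplicity x e.
Proof.
rewrite (partition_big x predT) //=; apply: eq_bigr => e _.
by rewrite -prodr_const; apply: eq_bigr => i /eqP ->.
Qed.

Lemma multiplicityE x e : multiplicity x e = count_mem e [tuple x i | i < n].
Proof.
by rewrite -sum1_count big_map big_enum_cond /= sum1_card.
Qed.

Lemma same_contentP x y :
  reflect (exists p, y = permute x p) (same_content x y).
Proof.
apply: (iffP forallP) => [eq_xy | [p ->] e]; last first.
  rewrite /multiplicity -!sum1_card [X in X == _](reindex_inj (@perm_inj _ p)).
  by apply/eqP/eq_bigl => i; rewrite !inE ffunE.
have /tuple_permP [p def_y] : perm_eq [tuple y i | i < n] [tuple x i | i < n].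
  by apply/allP => e _ /=; rewrite -!multiplicityE eq_sym.
exists p; apply/ffunP => i.
have /(congr1 (fun t : n.-tuple X => tnth t i)) := val_inj def_y.
by rewrite !tnth_mktuple ffunE.
Qed.

Lemma rearrangements_gt0 x y : (0 < rearrangements x y)%N = same_content x y.
Proof.
apply/card_gt0P/same_contentP => [[p /eqP <-] | [p ->]]; exists p => //.
by rewrite inE.
Qed.

Lemma rearrangements_inj x y :
  injective x -> rearrangements x y = same_content x y.
Proof.
move=> inj_x; apply/eqP; rewrite eqn_leq -rearrangements_gt0.
case: posnP => [-> //|r_gt0]; rewrite [X in _ && X]r_gt0 andbT.
apply/card_le1_eqP => p q; rewrite !inE => /eqP <- /eqP /ffunP eq_pq.
by apply/permP => i; apply/inj_x; have := eq_pq i; rewrite !ffunE.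
Qed.

Lemma sum_rearrangements x : (\sum_y rearrangements x y)%N = n`!.
Proof.
have <- : #|{perm 'I_n}| = n`! by rewrite card_Sn.
rewrite -sum1_card (partition_big (permute x) predT) //=.
by apply: eq_bigr => y _; rewrite sum1_card.
Qed.

Lemma rearrangements_le x y : (rearrangements x y <= n`!)%N.
Proof. by rewrite -(sum_rearrangements x) (bigD1 y) //= leq_addr. Qed.

(** The permutations taking [x] to [y] form a coset of the stabiliser of [y]. *)
Lemma rearrangements_same_content x y :
  same_content x y -> rearrangements y y = rearrangements x y.
Proof.
case/same_contentP => r ->; rewrite /rearrangements -!sum1_card.
rewrite [RHS](reindex_inj (mulIg r)); apply: eq_bigl => p; rewrite !inE.
by congr (_ == _); apply/ffunP => i; rewrite !ffunE permM.
Qed.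

End Rearrangements.

(** * Labelled words and the cost of repeated labels *)

(** A birthday bound: the proportion of label functions with a repetition is at most n^2 / N,
    written without subtraction or division. *)
Lemma expn_le_ffact N n :
  (N * N ^ n <= N * N ^_ n + n ^ 2 * N ^ n)%N.
Proof.
elim: n => [|n IH]; first by rewrite ffactn0 expn0 leq_addr.
have le_f : (N ^_ n <= N ^ n)%N.
  elim: n {IH} => // n IH; rewrite ffactnSr expnSr leq_mul ?leq_subr //.
rewrite ffactnSr expnSr; nia.
Qed.

(* Pairing [s] with distinct labels [t] turns rearrangements into mere equality
   of content; only the label functions that are not injective contribute an
   error. *)
Section Labels.

Variables (X : finType) (n N : nat).
Implicit Types s : {ffun 'I_n -> X}.
Implicit Types t : {ffun 'I_n -> 'I_N}.

Definition labelled s t : {ffun 'I_n -> X * 'I_N} := [ffun i => (s i, t i)].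

Definition labelled_matches s s' : nat :=
  \sum_t \sum_t' same_content (labelled s t) (labelled s' t').

(** A permutation [p] taking [s] to [s'] forces [t'] to be [permute t p], so the sum counts each
    such [p] once. *)
Lemma sum_labelled_rearrangements s s' t :
  (\sum_t' rearrangements (labelled s t) (labelled s' t'))%N
    = rearrangements s s'.
Proof.
rewrite /rearrangements -[RHS]sum1_card.
rewrite (partition_big (permute t) predT) //=.
apply: eq_bigr => t' _; rewrite sum1_card; apply: eq_card => p.
rewrite !inE; apply/eqP/andP => [/ffunP eq_p | [/eqP/ffunP es /eqP/ffunP et]].
  by split; apply/eqP/ffunP => i; have := eq_p i; rewrite !ffunE => -[].
by apply/ffunP => i; have := es i; have := et i; rewrite !ffunE => -> ->.
Qed.

Lemma labelled_matches_le s s' :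
  (labelled_matches s s' <= N ^ n * rearrangements s s')%N.
Proof.
have <- : #|{ffun 'I_n -> 'I_N}| = (N ^ n)%N by rewrite card_ffun !card_ord.
rewrite -sum_nat_const.
apply: leq_sum => t _; rewrite -(sum_labelled_rearrangements s s' t).
by apply: leq_sum => t' _; rewrite -rearrangements_gt0; case: rearrangements.
Qed.

(** For injective [t] the labelled word is injective, so its rearrangement counts are 0 or 1 and
    nothing is lost; every other [t] loses at most n!. *)
Lemma labelled_matches_ge s s' :
  (N ^ n * rearrangements s s'
     <= labelled_matches s s' + n`! * (N ^ n - N ^_ n))%N.
Proof.
have cardN : #|{ffun 'I_n -> 'I_N}| = (N ^ n)%N by rewrite card_ffun !card_ord.
pose inj := [pred t : {ffun 'I_n -> 'I_N} | injectiveb t].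
have cardI : #|inj| = (N ^_ n)%N.
  by have := card_inj_ffuns 'I_n 'I_N; rewrite !card_ord cardsE.
rewrite -{1}cardN -sum_nat_const /labelled_matches.
rewrite (bigID inj) /= [in leqRHS](bigID inj) /= -addnA leq_add //.
  apply: leq_sum => t /injectiveP inj_t.
  rewrite -(sum_labelled_rearrangements s s' t); apply: leq_sum => t' _.
  rewrite rearrangements_inj // => i j; rewrite !ffunE => -[_]; exact: inj_t.
apply: leq_trans (leq_addl _ _).
rewrite sum_nat_const mulnC leq_mul ?rearrangements_le // -cardI -cardN.
by rewrite -(cardC inj) addKn.
Qed.

End Labels.

(** * Moments of sums of roots of unity *)

Lemma primitive_root_exists (C : numClosedFieldType) m :
  (0 < m)%N -> exists w : C, m.-primitive_root w.
Proof.
move=> m_gt0; pose p : {poly C} := 'X^m - 1.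
have [r def_p] := closed_field_poly_normal p.
have mon_p : lead_coef p = 1 by apply/eqP/monic_Xn_sub_1.
rewrite mon_p scale1r in def_p.
have sz_r : size r = m.
  by apply: succn_inj; rewrite -(size_prod_XsubC r id) -def_p size_Xn_sub_1.
have /hasP [w _ w_prim] : has m.-primitive_root r.
  apply: has_prim_root; rewrite ?sz_r //.
    by apply/allP => z rz; rewrite /root_of_unity -/p def_p root_prod_XsubC.
  rewrite -separable_prod_XsubC -def_p.
  by apply: separable_Xn_sub_1; rewrite pnatr_eq0 -lt0n.
by exists w.
Qed.

Section UnityRootMoments.

Variables (C : numClosedFieldType) (M : nat) (w : C).
Hypothesis w_prim : M.-primitive_root w.

Lemma primitive_root_normC : w * w^* = 1.
Proof.
have M_gt0 := prim_order_gt0 w_prim.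
have : `|w| ^+ M = 1 by rewrite -normrX prim_expr_order ?normr1.
move/eqP; rewrite pexpr_eq1 // => /eqP w1.
by rewrite -normCK w1 expr1n.
Qed.

(** The sum is geometric with ratio [v], and [v] is 1 only when [a] and [b] agree because both are
    below the order [M] of [w]. *)
Lemma sum_unity_root_moment a b : (a < M)%N -> (b < M)%N ->
  \sum_(j < M) (w ^+ j) ^+ a * ((w ^+ j) ^+ b)^* = (M * (a == b))%:R.
Proof.
move=> a_lt b_lt; pose v := w ^+ a * (w ^+ b)^*.
rewrite (eq_bigr (fun j : 'I_M => v ^+ j)); last first.
  move=> j _; rewrite /v exprMn -!exprM (mulnC j a) (mulnC j b).
  by congr (_ * _); rewrite !rmorphXn -exprM.
have vb : v * w ^+ b = w ^+ a.
  rewrite /v -mulrA [X in _ * X]mulrC rmorphXn /= -exprMn.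
  by rewrite primitive_root_normC expr1n mulr1.
have eq_v : (v == 1) = (a == b).
  rewrite -(inj_eq (mulIf (_ : w ^+ b != 0))); last first.
    by rewrite expf_neq0 ?(prim_root_eq0 w_prim) // -lt0n (leq_ltn_trans _ a_lt).
  by rewrite vb mul1r (eq_prim_root_expr w_prim) !modn_small.
rewrite -eq_v; case: eqP => [-> | /eqP v1].
  rewrite (eq_bigr (fun=> 1)) ?sumr_const ?card_ord ?muln1 // => j _.
  by rewrite expr1n.
have vM : v ^+ M = 1.
  rewrite /v exprMn -exprM mulnC exprM (prim_expr_order w_prim) expr1n mul1r.
  by rewrite -rmorphXn -exprM mulnC exprM (prim_expr_order w_prim) expr1n rmorph1.
apply: (mulfI (_ : v - 1 != 0)); first by rewrite subr_eq0.
by rewrite -subrX1 vM subrr muln0 mulr0.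
Qed.

(** Grouping positions by letter factors the sum over [f] into one-variable moments whose exponents
    are multiplicities, hence at most [n] and below [M]. *)
Lemma sum_torus_moment (X : finType) n (x y : {ffun 'I_n -> X}) : (n < M)%N ->
  \sum_(f : {ffun X -> 'I_M})
      (\prod_i w ^+ f (x i)) * (\prod_i w ^+ f (y i))^*
    = (M ^ #|X| * same_content x y)%:R.
Proof.
move=> n_lt.
transitivity (\prod_(e : X) \sum_(j < M)
    (w ^+ j) ^+ multiplicity x e * ((w ^+ j) ^+ multiplicity y e)^*).
  rewrite bigA_distr_bigA; apply: eq_bigr => f _.
  rewrite (prod_multiplicity (fun e => w ^+ f e) x).
  by rewrite (prod_multiplicity (fun e => w ^+ f e) y) rmorph_prod big_split.
under eq_bigr => e _ do rewrite sum_unity_root_moment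
  ?(leq_ltn_trans (multiplicity_le _ _)) // natrM.
rewrite big_split /= prodr_const natrM natrX; congr (_ * _).
rewrite /same_content; case: forallP => [eq_xy | neq_xy].
  by rewrite big1 // => e _; rewrite eq_xy.
have /existsP [e /negPf ne] : [exists e, multiplicity x e != multiplicity y e].
  by rewrite -negb_forall; apply/forallP.
by rewrite (bigD1 e) //= ne mul0r.
Qed.

Variables (S : finType) (N : nat).
Implicit Type f : {ffun S * 'I_N -> 'I_M}.

(** The stand-in for a Gaussian: for uniform [f], these are independent sums of [N] uniform roots of
    unity, left unnormalised. *)
Definition root_sum f s : C := \sum_(t < N) w ^+ f (s, t).

(** Expanding the products chooses a label at each position, which reduces to moments of words over
    [S * 'I_N]. *)
Lemma sum_root_sum_moment n (s s' : {ffun 'I_n -> S}) : (n < M)%N ->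
  \sum_f (\prod_i root_sum f (s i)) * (\prod_i root_sum f (s' i))^*
    = (M ^ #|{: S * 'I_N}| * labelled_matches N s s')%:R.
Proof.
move=> n_lt.
pose P f (s0 : {ffun 'I_n -> S}) (t : {ffun 'I_n -> 'I_N}) :=
  \prod_i w ^+ f (labelled s0 t i).
have prod_root_sum f (s0 : {ffun 'I_n -> S}) : \prod_i root_sum f (s0 i)
    = \sum_(t : {ffun 'I_n -> 'I_N}) P f s0 t.
  rewrite bigA_distr_bigA; apply: eq_bigr => t _.
  by apply: eq_bigr => i _; rewrite ffunE.
under eq_bigr => f _ do rewrite !prod_root_sum rmorph_sum mulr_suml.
under eq_bigr => f _ do under eq_bigr => t _ do rewrite mulr_sumr.
rewrite exchange_big /labelled_matches natrM natr_sum mulr_sumr.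
apply: eq_bigr => t _; rewrite exchange_big natr_sum mulr_sumr.
by apply: eq_bigr => t' _; rewrite /P sum_torus_moment // natrM.
Qed.

End UnityRootMoments.

(** * From AM-GM to a bound on the permanent *)

Section PermanentBound.

Variables (C : numClosedFieldType) (n : nat) (S : finType).
Variables (V : 'I_n -> S -> C) (d : S -> C).
Hypothesis V_orth :
  forall s s', \sum_i V i s * (V i s')^* = if s == s' then d s else 0.

(** Contribution of the word [s] to the expansion of prod_i z_i, where z_i = sum_s V_is g_s. *)
Let coef (s : {ffun 'I_n -> S}) := \prod_i V i (s i).

(** AM-GM applied to the |z_i|^2 at each [f], then summed over [f]: the left side collects n^n
    prod_i |z_i|^2, the right side (sum_i |z_i|^2)^n. *)
Lemma AGM_labelled_matches N :
  n%:R ^+ n * \sum_s \sum_s' coef s * (coef s')^* * (labelled_matches N s s')%:R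
    <= \sum_(s : {ffun 'I_n -> S}) (\prod_i d (s i)) * (labelled_matches N s s)%:R.
Proof.
have [w w_prim] := primitive_root_exists C (ltn0Sn n).
(* [K] is the number of functions [f], the factor common to all the moments; roots of order [n.+1]
   make the degree [n] admissible. *)
pose K : C := (n.+1 ^ #|{: S * 'I_N}|)%:R.
have K_gt0 : 0 < K by rewrite ltr0n expn_gt0.
rewrite -(ler_pM2l K_gt0).
pose g (f : {ffun S * 'I_N -> 'I_n.+1}) s := root_sum w f s.
pose z f i := \sum_s V i s * g f s.
have prod_z f : \prod_i z f i
    = \sum_(s : {ffun 'I_n -> S}) coef s * \prod_i g f (s i).
  by rewrite bigA_distr_bigA; apply: eq_bigr => s _; rewrite big_split.
(* Orthogonality of the columns of [V] removes the cross terms. *)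
have sum_z f : \sum_i z f i * (z f i)^* = \sum_s d s * (g f s * (g f s)^*).
  under eq_bigr => i _ do rewrite rmorph_sum mulr_suml.
  rewrite exchange_big; apply: eq_bigr => s _ /=.
  under eq_bigr => i _ do rewrite mulr_sumr.
  rewrite exchange_big (bigD1 s) //= [X in _ + X]big1 => [|s' ne].
    have := V_orth s s; rewrite eqxx addr0 => <-; rewrite mulr_suml.
    by apply: eq_bigr => i _; rewrite rmorphM /=; ring.
  transitivity ((\sum_i V i s * (V i s')^* ) * (g f s * (g f s')^*)); last first.
    by rewrite V_orth eq_sym (negPf ne) mul0r.
  rewrite mulr_suml.
  by apply: eq_bigr => i _; rewrite rmorphM /=; ring.
have -> : K * (n%:R ^+ n * \sum_s \sum_s'
    coef s * (coef s')^* * (labelled_matches N s s')%:R)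
  = \sum_f \prod_i (z f i * (z f i)^* *+ n).
  have E f : \prod_i (z f i * (z f i)^* *+ n) = n%:R ^+ n *
      \sum_s \sum_s' coef s * (coef s')^* *
        ((\prod_i g f (s i)) * (\prod_i g f (s' i))^*).
    under eq_bigr => i _ do rewrite -mulr_natl.
    rewrite big_split /= prodr_const card_ord; congr (_ * _).
    rewrite big_split /= -rmorph_prod prod_z rmorph_sum mulr_suml.
    apply: eq_bigr => s _; rewrite mulr_sumr; apply: eq_bigr => s' _.
    by rewrite rmorphM /=; ring.
  rewrite (eq_bigr _ (fun f _ => E f)) -mulr_sumr mulrCA; congr (_ * _).
  rewrite [RHS]exchange_big mulr_sumr. apply: eq_bigr => s _.
  rewrite [RHS]exchange_big mulr_sumr; apply: eq_bigr => s' _.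
  by rewrite -mulr_sumr sum_root_sum_moment // natrM -/K mulrCA.
have -> : K * (\sum_(s : {ffun 'I_n -> S})
    (\prod_i d (s i)) * (labelled_matches N s s)%:R)
  = \sum_f (\sum_i z f i * (z f i)^*) ^+ n.
  have E f : (\sum_i z f i * (z f i)^*) ^+ n
      = \sum_(s : {ffun 'I_n -> S}) (\prod_i d (s i)) *
        ((\prod_i g f (s i)) * (\prod_i g f (s i))^*).
    rewrite sum_z -[in LHS](card_ord n) -prodr_const bigA_distr_bigA.
    by apply: eq_bigr => s _; rewrite rmorph_prod !big_split.
  rewrite (eq_bigr _ (fun f _ => E f)) [RHS]exchange_big mulr_sumr.
  apply: eq_bigr => s _.
  by rewrite -mulr_sumr sum_root_sum_moment // natrM -/K mulrCA.
apply: ler_sum => f _.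
have := leif_AGM_scaled (A := 'I_n) (E := fun i => z f i * (z f i)^*).
rewrite card_ord => AGM; apply: (AGM _).1 => i _.
by rewrite mulrn_wge0 // mul_conjC_ge0.
Qed.

(** The Wick formula Perm(A) = E prod_i |z_i|^2: expand each entry of [A], move the permutation onto
    the conjugated word, and group by the resulting word [s']. *)
Lemma permanent_gram (A : 'M[C]_n) :
    (forall i j, A i j = \sum_s V i s * (V j s)^*) ->
  permanent A
    = \sum_s \sum_s' coef s * (coef s')^* * (rearrangements s s')%:R.
Proof.
move=> A_gram.
transitivity (\sum_(p : 'S_n) \sum_s coef s * (coef (permute s p))^*).
  rewrite /permanent (reindex_inj invg_inj); apply: eq_bigr => p _.
  under eq_bigr => i _ do rewrite A_gram.
  rewrite bigA_distr_bigA; apply: eq_bigr => s _.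
  rewrite big_split rmorph_prod; congr (_ * _) => /=.
  rewrite (reindex_inj (@perm_inj _ p)); apply: eq_bigr => i _.
  by rewrite permK ffunE.
rewrite exchange_big; apply: eq_bigr => s _.
rewrite (partition_big (permute s) predT) //=; apply: eq_bigr => s' _.
rewrite /rearrangements -[in RHS]sum1_card natr_sum mulr_sumr.
by apply: eq_big => p // /eqP ->; rewrite mulr1.
Qed.

Hypothesis d_ge0 : forall s, 0 <= d s.

(** Replacing [labelled_matches] by [N ^ n * rearrangements] costs a relative error of order 1/N, so
    after scaling by [N] the error is a constant [B], uniform in [N]. *)
Lemma AGM_rearrangements (P : C) :
    P = \sum_s \sum_s' coef s * (coef s')^* * (rearrangements s s')%:R ->
    P \is Num.real ->
  exists2 B : C, 0 <= B & forall N, (0 < N)%N ->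
    N%:R * (n%:R ^+ n * P) <= N%:R *
      (\sum_(s : {ffun 'I_n -> S}) (\prod_i d (s i)) * (rearrangements s s)%:R)
      + B.
Proof.
move=> def_P P_real; set Q := \sum_s _.
pose B0 : C := \sum_s \sum_s' `|coef s * (coef s')^*| * n`!%:R.
have B0_ge0 : 0 <= B0.
  by apply: sumr_ge0 => s _; apply: sumr_ge0 => s' _; rewrite mulr_ge0.
exists (n%:R ^+ n * B0 * (n ^ 2)%:R) => [|N N_gt0].
  by rewrite !mulr_ge0 ?exprn_ge0.
pose a := \sum_s \sum_s' coef s * (coef s')^* * (labelled_matches N s s')%:R.
have AGM : n%:R ^+ n * a <= \sum_(s : {ffun 'I_n -> S})
    (\prod_i d (s i)) * (labelled_matches N s s)%:R.
  exact: AGM_labelled_matches.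
have bound_Q : \sum_(s : {ffun 'I_n -> S})
    (\prod_i d (s i)) * (labelled_matches N s s)%:R <= (N ^ n)%:R * Q.
  rewrite mulr_sumr; apply: ler_sum => s _; rewrite mulrCA.
  by rewrite ler_wpM2l ?prodr_ge0 // -natrM ler_nat labelled_matches_le.
have Q_ge0 : 0 <= Q.
  by apply: sumr_ge0 => s _; rewrite mulr_ge0 ?prodr_ge0.
have le_a := le_trans AGM bound_Q.
have err : `|(N ^ n)%:R * P - a| <= B0 * (N ^ n - N ^_ n)%:R.
  rewrite def_P /a /B0 mulr_sumr -sumrB mulr_suml.
  apply: le_trans (ler_norm_sum _ _ _) _; apply: ler_sum => s _.
  rewrite mulr_sumr -sumrB mulr_suml.
  apply: le_trans (ler_norm_sum _ _ _) _; apply: ler_sum => s' _.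
  rewrite mulrCA -mulrBr normrM -mulrA ler_wpM2l // -!natrM.
  rewrite -natrB ?labelled_matches_le // normr_nat ler_nat leq_subLR.
  exact: labelled_matches_ge.
have nn_gt0 : 0 < n%:R ^+ n :> C.
  by case: (posnP n) => [-> | n_gt0]; rewrite ?expr0 ?ltr01 // exprn_gt0 ?ltr0n.
(* The order on [C] is partial: [a] is real because a positive multiple of it is comparable with a
   nonnegative number. *)
have a_real : a \is Num.real.
  have : n%:R ^+ n * a \is Num.real.
    by rewrite (ler_real le_a) // ger0_real // mulr_ge0.
  move=> na; rewrite -[a](mulKf (lt0r_neq0 nn_gt0)).
  by rewrite realM // realV gtr0_real.
have diff_real : (N ^ n)%:R * P - a \is Num.real.
  by rewrite realB // realM.
have le1 : (N ^ n)%:R * P <= a + B0 * (N ^ n - N ^_ n)%:R.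
  rewrite addrC -lerBlDr.
  exact: le_trans (real_ler_norm diff_real) err.
have le2 : (N ^ n)%:R * (n%:R ^+ n * P)
    <= (N ^ n)%:R * Q + n%:R ^+ n * B0 * (N ^ n - N ^_ n)%:R.
  rewrite mulrCA -mulrA.
  apply: le_trans (_ : _ <= n%:R ^+ n * (a + B0 * (N ^ n - N ^_ n)%:R)) _.
    by rewrite ler_pM2l.
  by rewrite mulrDr lerD2r.
have Nn_gt0 : 0 < (N ^ n)%:R :> C by rewrite ltr0n expn_gt0 N_gt0.
rewrite -(ler_pM2l Nn_gt0) mulrDr.
have -> : (N ^ n)%:R * (N%:R * (n%:R ^+ n * P))
  = N%:R * ((N ^ n)%:R * (n%:R ^+ n * P)) by ring.
apply: le_trans (_ : _ <= N%:R *
    ((N ^ n)%:R * Q + n%:R ^+ n * B0 * (N ^ n - N ^_ n)%:R)) _.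
  by rewrite ler_wpM2l.
have -> : (N ^ n)%:R * (n%:R ^+ n * B0 * (n ^ 2)%:R)
  = n%:R ^+ n * B0 * (n ^ 2 * N ^ n)%:R by rewrite natrM; ring.
(* What remains is [N * (N ^ n - N ^_ n) <= n ^ 2 * N ^ n], the source of the factor [n ^ 2] in
   [B]. *)
rewrite mulrDr mulrCA lerD2l mulrCA -natrM.
rewrite ler_wpM2l ?mulr_ge0 ?exprn_ge0 // ler_nat mulnBr leq_subLR.
exact: expn_le_ffact.
Qed.

End PermanentBound.

(** * Bounding the complete homogeneous polynomial *)

(** The words of one content have rearrangement counts adding up to n!, so the left side is n!
    h_n(d). Letting the exponents off [s0] range freely over 0..n gives a product of truncated
    geometric series. *)
Lemma sum_weighted_rearrangements (R : numFieldType) (S : finType) n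
    (d : S -> R) s0 :
    d s0 = 1 -> (forall s, 0 <= d s) -> (forall s, s != s0 -> d s < 1) ->
  \sum_(x : {ffun 'I_n -> S}) (\prod_i d (x i)) * (rearrangements x x)%:R
    <= n`!%:R * \prod_(s | s != s0) (1 - d s)^-1.
Proof.
move=> d1 d_ge0 d_lt1.
(* The multiplicity of [s0] is determined by the others, and its weight is 1. *)
pose F s (k : 'I_n.+1) : R := if s == s0 then (k == ord0)%:R else d s ^+ k.
pose b (x : {ffun 'I_n -> S}) : {ffun S -> 'I_n.+1} :=
  [ffun s => if s == s0 then ord0 else inord (multiplicity x s)].
have F_ge0 s k : 0 <= F s k.
  by rewrite /F; case: ifP => // _; rewrite exprn_ge0.
have bE x s : s != s0 -> b x s = multiplicity x s :> nat.
  by move=> /negPf ne; rewrite ffunE ne inordK // ltnS multiplicity_le.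
have weightE (x : {ffun 'I_n -> S}) : \prod_i d (x i) = \prod_s F s (b x s).
  rewrite prod_multiplicity; apply: eq_bigr => s _; rewrite /F.
  case: eqVneq => [-> | ne]; first by rewrite d1 expr1n ffunE !eqxx.
  by rewrite bE.
have b_inj x y : b x = b y -> same_content x y.
  move=> eq_b; have eq_s s : s != s0 -> multiplicity x s = multiplicity y s.
    by move=> ne; rewrite -!bE // eq_b.
  apply/forallP => s; apply/eqP; case: (eqVneq s s0) => [-> | /eq_s //].
  have := sum_multiplicity x; rewrite -{2}(sum_multiplicity y).
  rewrite (bigD1 s0) //= [in RHS](bigD1 s0) //= (eq_bigr _ eq_s).
  exact: addIn.
rewrite (partition_big b predT) //=.
apply: le_trans (_ : _ <=
    \sum_(c : {ffun S -> 'I_n.+1}) n`!%:R * \prod_s F s (c s)) _.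
  apply: ler_sum => c _.
  have w_ge0 : 0 <= \prod_s F s (c s) by apply: prodr_ge0.
  (* An exponent vector [c] that no word attains contributes 0; otherwise [x0] represents its
     class. *)
  case: (pickP (fun x => b x == c)) => [x0 /eqP bx0 | none]; last first.
    by rewrite big_pred0 // mulr_ge0.
  rewrite mulrC (eq_bigr (fun x => (\prod_s F s (c s))
      * (rearrangements x0 x)%:R)) => [|x /eqP bx].
    rewrite -mulr_sumr ler_wpM2l // -natr_sum ler_nat -(sum_rearrangements x0).
    by rewrite [leqRHS](bigID (fun x => b x == c)) leq_addr.
  by rewrite weightE bx (rearrangements_same_content (b_inj x0 x _)) ?bx.
(* The sum over [c] factors over the letters; the factor at [s0] is 1, from its only nonzero term
   [ord0]. *)
rewrite -mulr_sumr ler_wpM2l // -bigA_distr_bigA (bigD1 s0) //=.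
rewrite {1}/F eqxx (bigD1 ord0) //= big1 => [|k /negPf -> //].
rewrite addr0 mul1r; apply: ler_prod => s ne.
rewrite sumr_ge0 //= /F (negPf ne).
have gap : 0 < 1 - d s by rewrite subr_gt0 d_lt1.
rewrite -(ler_pM2l gap) divff ?gt_eqF //.
rewrite -opprB mulNr -subrX1 opprB gerBl.
by rewrite exprn_ge0.
Qed.

(** * Spectral decomposition of a Hermitian matrix *)

Lemma char_poly_conj (R : comNzRingType) n (Q D P : 'M[R]_n) :
  Q *m P = 1%:M -> char_poly (Q *m D *m P) = char_poly D.
Proof.
move=> QP; rewrite /char_poly.
have QPC : map_mx polyC Q *m map_mx polyC P = 1%:M.
  by rewrite -map_mxM QP map_mx1.
have -> : char_poly_mx (Q *m D *m P)
    = map_mx polyC Q *m char_poly_mx D *m map_mx polyC P.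
  rewrite /char_poly_mx !map_mxM mulmxBr mulmxBl; congr (_ - _).
  by rewrite scalar_mxC -mulmxA QPC mulmx1.
by rewrite !det_mulmx mulrAC -det_mulmx QPC det1 mul1r.
Qed.

(** Unitary diagonalisation, with each eigenvector scaled by the square root of its eigenvalue to
    form a column of [V]. *)
Lemma hermitian_gram (C : numClosedFieldType) n (A : 'M[C]_n) (r : seq C) :
    A \is hermsymmx -> (forall x, x \in r -> 0 <= x) ->
    char_poly A = \prod_(x <- r) ('X - x%:P) ->
  exists (d : 'I_n -> C) (V : 'I_n -> 'I_n -> C),
  [/\ perm_eq [tuple d s | s < n] r,
      forall i j, A i j = \sum_s V i s * (V j s)^*
    & forall s s', \sum_i V i s * (V i s')^* = if s == s' then d s else 0].
Proof.
move=> A_herm r_ge0 char_A.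
have /orthomx_spectralP := hermitian_normalmx A_herm.
set P := spectralmx A; set D := spectral_diag A => def_A.
have P_unitary : P \is unitarymx := spectral_unitarymx A.
have perm_D : perm_eq [tuple D 0 s | s < n] r.
  apply: prod_XsubC_eq; rewrite -char_A [in RHS]def_A char_poly_conj.
    rewrite char_poly_trig ?diag_mx_is_trig // big_tuple.
    by apply: eq_bigr => i _; rewrite tnth_mktuple !mxE eqxx.
  by rewrite mulVmx ?unitarymx_unit.
have D_ge0 s : 0 <= D 0 s.
  apply: r_ge0; rewrite -(perm_mem perm_D).
  by apply/tnthP; exists s; rewrite tnth_mktuple.
pose q s := sqrtC (D 0 s).
have q_real s : (q s)^* = q s by rewrite conj_Creal ?ger0_real ?sqrtC_ge0.
have q2 s : q s * q s = D 0 s by rewrite -expr2 sqrtCK.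
exists (fun s => D 0 s), (fun i s => (P s i)^* * q s); split=> //.
  move=> i j; rewrite {1}def_A invmx_unitary // mxE; apply: eq_bigr => s _.
  rewrite mul_mx_diag !mxE rmorphM /= conjCK q_real -q2; ring.
move=> s s'.
have orth : \sum_i P s' i * (P s i)^* = (s' == s)%:R.
  have /matrixP /(_ s' s) := unitarymxP P_unitary; rewrite !mxE => <-.
  by apply: eq_bigr => i _; rewrite !mxE.
transitivity (q s * q s' * \sum_i P s' i * (P s i)^*).
  rewrite mulr_sumr; apply: eq_bigr => i _.
  by rewrite rmorphM /= conjCK q_real; ring.
rewrite orth eq_sym; case: eqP => [<-|_]; last by rewrite mulr0.
by rewrite mulr1 q2.
Qed.

(** * Passage to the limit and conclusion *)

(** If [y < x], any [N] above [B / (x - y)] violates the hypothesis. *)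
Lemma archimedean_le (R : realType) (x y B : R) :
  (forall N, (0 < N)%N -> N%:R * x <= N%:R * y + B) -> x <= y.
Proof.
move=> le_N; rewrite leNgt; apply/negP => lt_yx.
have gap : 0 < x - y by rewrite subr_gt0.
have [B_le0 | B_gt0] := leP B 0; first by have := le_N 1%N isT; lra.
have /archi_boundP : 0 <= B / (x - y) by rewrite ltW ?divr_gt0.
set N := Num.bound _; rewrite ltr_pdivrMr // => lt_N.
have := le_N N; case: (posnP N) lt_N => [-> | N_gt0 lt_N /(_ isT)]; first by lra.
by apply/negP; rewrite -ltNge; lra.
Qed.

Theorem mainTheorem6 (R : realType) (n : nat) (A : 'M[R]_n) (lam : nat -> R)
    (n_gt0 : (0 < n)%N)
    (A_sym : A \is symmetricmx)
    (A_psd : positive_semidefinite A)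
    (A_ds : doubly_stochastic A)
    (lam_eig : eigenvalues_of A lam)
    (lam1 : lam 1%N = 1)
    (lam2 : (1 < n)%N -> lam 2%N < lam 1%N)
    (lam_noninc : forall i : nat, (2 <= i < n)%N -> lam i.+1 <= lam i)
    (lam_ge0 : 0 <= lam n) :
  permanent A <=
    n`!%:R / n%:R ^+ n * \prod_(2 <= i < n.+1) (1 / (1 - lam i)).
Proof.
have lam_lt1 i : (2 <= i <= n)%N -> lam i < 1.
  case/andP; elim: i => // i IH; rewrite ltnS leq_eqVlt => /predU1P[<- | i_gt1 i_lt].
    by move=> n_gt1; rewrite -lam1 lam2.
  by apply: le_lt_trans (IH i_gt1 (ltnW i_lt)); rewrite lam_noninc ?i_gt1.
(* Monotonicity starts at index 2, so index 1 uses [lam1], and the others descend from [lam n] by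
   induction on [n - i]. *)
have lam_pos i : (1 <= i <= n)%N -> 0 <= lam i.
  rewrite leq_eqVlt; case/andP => /predU1P[<- _ | i_gt1]; first by rewrite lam1.
  move/subnKC; move: (n - i)%N => k; elim: k i i_gt1 => [|k IH] i i_gt1 def_n.
    by rewrite -(addn0 i) def_n.
  apply: le_trans (IH i.+1 _ _) (lam_noninc _ _); rewrite ?addSnnS //; lia.
have [m def_n] : exists m, n = m.+1 by exists n.-1; rewrite prednK.
subst n; set n := m.+1
  in A A_sym A_psd A_ds lam_eig lam2 lam_noninc lam_ge0 lam_lt1 lam_pos *.
(* The spectral theorem and the roots of unity call for a closed field. *)
pose AC : 'M[(complex R)]_n := map_mx (real_complex R) A.
pose r := [tuple (lam i.+1)%:C%C | i < n].
have AC_herm : AC \is hermsymmx.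
  apply/is_hermitianmxP; rewrite expr0 scale1r.
  have /is_hermitianmxP := A_sym; rewrite expr0 scale1r => /matrixP eq_A.
  apply/matrixP => i j; rewrite !mxE {1}eq_A !mxE /=.
  by rewrite conj_Creal // complex_real.
have char_AC : char_poly AC = \prod_(x <- r) ('X - x%:P).
  rewrite -map_char_poly lam_eig rmorph_prod big_tuple big_add1 big_mkord.
  by apply: eq_bigr => i _; rewrite tnth_mktuple rmorphB /= map_polyX map_polyC.
have r_ge0 x : x \in r -> 0 <= x.
  by case/tnthP => i ->; rewrite tnth_mktuple lecR lam_pos //= ltn_ord.
have [d [V [perm_d A_gram V_orth]]] := hermitian_gram AC_herm r_ge0 char_AC.
have /tuple_permP [p def_d] := perm_d.
have dE s : d s = (lam (p s).+1)%:C%C.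
  have /(congr1 (fun t : n.-tuple (complex R) => tnth t s)) := val_inj def_d.
  by rewrite !tnth_mktuple.
have d_ge0 s : 0 <= d s by rewrite dE lecR lam_pos //= ltn_ord.
(* [p] matches spectral indices with the given order of the eigenvalues, shifted by one; [s0] is the
   index carrying [lam 1]. *)
pose s0 := (p^-1 ord0)%g.
have d_s0 : d s0 = 1 by rewrite dE /s0 permKV lam1.
have d_lt1 s : s != s0 -> d s < 1.
  move=> ne; rewrite dE ltcR lam_lt1 //= ltn_ord andbT ltnS lt0n.
  apply: contraNneq ne => p0; rewrite -[s](permK p); apply/eqP; congr (_ _).
  exact: val_inj.
have permE : (permanent A)%:C%C = permanent AC.
  rewrite /permanent rmorph_sum; apply: eq_bigr => s _.
  by rewrite rmorph_prod; apply: eq_bigr => i _; rewrite mxE.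
have perm_real : (permanent A)%:C%C \is Num.real by rewrite complex_real.
have := permanent_gram A_gram; rewrite -permE => def_perm.
have [B B_ge0 le_N] := AGM_rearrangements V_orth d_ge0 def_perm perm_real.
have := sum_weighted_rearrangements n d_s0 d_ge0 d_lt1.
set Q := \sum_x _ in le_N *.
have -> : \prod_(s | s != s0) (1 - d s)^-1
    = (\prod_(2 <= i < n.+1) (1 / (1 - lam i)))%:C%C.
  rewrite (reindex_inj (@perm_inj _ p^-1%g)) rmorph_prod !big_add1 big_mkord.
  rewrite (eq_bigl (fun i => i != ord0)) => [|i]; last first.
    by rewrite (inj_eq perm_inj).
  rewrite [in LHS]big_mkcond big_ord_recl /= mul1r.
  apply: eq_bigr => i _.
  by rewrite /= dE permKV lift0 div1r fmorphV rmorphB rmorph1.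
move=> le_Q.
rewrite mulrAC ler_pdivlMr ?exprn_gt0 ?ltr0n // mulrC.
apply: (archimedean_le (B := complex.Re B)) => N N_gt0.
(* A nonnegative element of [complex R] is real, so [B] descends to [R], where the archimedean
   argument takes place. *)
have B_real : B = (complex.Re B)%:C%C by apply/esym/RRe_real/ger0_real.
rewrite -lecR rmorphD !rmorphM rmorphXn !rmorph_nat /= -B_real.
by apply: le_trans (le_N N N_gt0) _; rewrite lerD2r ler_wpM2l.
Qed.
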